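(* Let $X_n$ be the number of correct guesses under the optimal strategy in the complete feedback game after one symmetric (i.e. $p=\frac12$) single-shelf shuffle of $n$ cards. Then $X_n/n$ satisfies a large deviation principle with speed $n$ and good rate function \[ I_{1/2}(x)=(2x-1)\log(2x-1)+2(1-x)\log(1-x)+(3-2x)\log 2 \] when $x\in[1/2,1]$ (with $0\log0=0$), and $I_{1/2}(x)=+\infty$ otherwise.
   Context: Symmetric single-shelf shuffle: start with an ordered deck of $n$ cards labelled $1,\dots,n$ (card $1$ on top). Cards are drawn one at a time from the bottom of the deck (card $n$ first, card $1$ last) and placed in a pile; independently, each drawn card is placed at the top or at the bottom of the pile with probability $\frac12$ each. Equivalently, let $\varepsilon_1,\dots,\varepsilon_{n-1}$ be independent Bernoulli$(\frac12)$; the shuffled deck read from the top consists of the cards $j\le n-1$ with $\varepsilon_j=1$ in increasing order, then card $n$, then the cards with $\varepsilon_j=0$ in decreasing order. Complete feedback game: the player guesses the cards of the shuffled deck sequentially from the top; after each guess the card is shown and removed. Optimal strategy used: guess $1$ first, then always guess the successor $j+1$ of the last shown card $j$ until card $n$ or $n-1$ has been shown; afterwards guess the remaining cards in decreasing order. $X_n$ is the number of correct guesses under this strategy. A good rate function is a lower semicontinuous $I:\mathbb{R}\to[0,+\infty]$ whose level sets $\{x\in\mathbb{R}: I(x)\le\alpha\}$ are compact for all $\alpha\in[0,\infty)$. A sequence of real random variables $(Y_n)_{n\ge1}$ satisfies a large deviation principle with speed $n$ and good rate function $I$ if for every Borel set $A\subseteq\mathbb{R}$, with interior $A^\circ$ and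 closure $\overline{A}$, \[ -\inf_{x\in A^\circ}I(x)\le\liminf_{n\to\infty}\frac1n\log\mathbb{P}(Y_n\in A)\le\limsup_{n\to\infty}\frac1n\log\mathbb{P}(Y_n\in A)\le-\inf_{x\in\overline{A}}I(x). \] *)

(* Defs.v *)
From HB Require Import structures.
From mathcomp Require Import all_boot all_order all_algebra.
From mathcomp Require Import all_classical all_reals all_analysis.

Set Implicit Arguments.
Unset Strict Implicit.
Unset Printing Implicit Defensive.

Import Order.TTheory GRing.Theory Num.Theory.
Import numFieldNormedType.Exports.

Local Open Scope classical_set_scope.
Local Open Scope ring_scope.

(* Decks are sequences of cards in [1, n], listed from the top; card j.+1 is
   governed by the coin of index j : 'I_n, whose value [true] sends the card to
   the top of the pile. The coin of card n is immaterial, see [shuffleE]. *)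
Definition put_card n (coin : 'I_n -> bool) (pile : seq nat) (j : 'I_n) :
    seq nat :=
  if coin j then j.+1 :: pile else rcons pile j.+1.

Definition shuffle n (coin : 'I_n -> bool) : seq nat :=
  foldl (put_card coin) [::] (rev (enum 'I_n)).

(* [coin'] stands for the coins of the cards 1, ..., n of an (n+1)-card deck. *)
Lemma shuffleE n (coin : 'I_n.+1 -> bool) :
  let coin' (j : 'I_n) := coin (widen_ord (leqnSn n) j) in
  shuffle coin = [seq (val j).+1 | j <- enum 'I_n & coin' j] ++
    n.+1 :: rev [seq (val j).+1 | j <- enum 'I_n & ~~ coin' j].
Proof.
move=> coin'; rewrite /shuffle enum_ordSr rev_rcons /= {2}/put_card /=.
rewrite if_same -map_rev; elim: (enum 'I_n) => [//|j s IHs].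
rewrite [rev (j :: s)]rev_cons map_rcons foldl_rcons IHs {1}/put_card /=.
rewrite -/(coin' j); case: ifPn => //= _.
by rewrite rev_cons -rcons_cons -rcons_cat.
Qed.

(* A strategy maps the cards shown so far, in order of appearance, to the next
   guess. *)
Definition correct_guesses (strategy : seq nat -> nat) (deck : seq nat) : nat :=
  (\sum_(i < size deck) (strategy (take i deck) == nth 0 deck i))%N.

(* With no card shown, [last 0 shown] is 0 and the guess is card 1. Guessing the
   remaining cards in decreasing order means guessing the largest one. *)
Definition optimal_guess n (shown : seq nat) : nat :=
  if (n \in shown) || (n.-1 \in shown)
  then (\max_(1 <= j < n.+1 | j \notin shown) j)%N
  else (last 0%N shown).+1.

Definition nb_correct n (coin : 'I_n -> bool) : nat :=
  correct_guesses (optimal_guess n) (shuffle coin).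

Definition correct_ratio d (T : measurableType d) (R : realType)
    (P : probability T R) n (coin : 'I_n -> {RV P >-> bool}) (w : T) : R :=
  (nb_correct (fun j => coin j w))%:R / n%:R.

Section correct_ratio_RV.
Context d (T : measurableType d) (R : realType) (P : probability T R) (n : nat).
Variable coin : 'I_n -> {RV P >-> bool}.

Let measurable_correct_ratio : measurable_fun setT (correct_ratio coin).
Proof.
move=> _ B mB; rewrite setTI.
pose F (f : {ffun 'I_n -> bool}) : R := (nb_correct f)%:R / n%:R.
have -> : correct_ratio coin @^-1` B =
    \bigcup_(f in F @^-1` B) \bigcap_j (coin j @^-1` [set f j]).
  have FE w (f : {ffun 'I_n -> bool}) :
      (forall j, coin j w = f j) -> correct_ratio coin w = F f.
    move=> fw; rewrite /F /correct_ratio.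
    by congr ((nb_correct _)%:R / _); exact/funext.
  apply/seteqP; split => [w Bw|w [f Bf fw]].
    exists [ffun j => coin j w] => [|j _]; last by rewrite /preimage /= ffunE.
    by rewrite /preimage mksetE -(FE w) // => j; rewrite ffunE.
  by rewrite /preimage mksetE (FE w f) // => j; exact: fw.
apply: fin_bigcup_measurable => [|f _]; first exact: finite_finset.
apply: fin_bigcap_measurable => [|j _]; first exact: finite_finset.
by rewrite -[X in measurable X]setTI; exact: measurable_funP.
Qed.

HB.instance Definition _ :=
  isMeasurableFun.Build _ _ _ _ (correct_ratio coin) measurable_correct_ratio.

End correct_ratio_RV.

Definition mutually_independent d d' (T : measurableType d)
    (T' : measurableType d') (R : realType) (P : probability T R) (I : finType)
    (Y : I -> {RV P >-> T'}) : Prop :=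
  forall (J : {set I}) (B : I -> set T'), (forall i, measurable (B i)) ->
    P (\bigcap_(i in [set` J]) (Y i @^-1` B i)) =
    (\prod_(i in J) P (Y i @^-1` B i))%E.

Definition good_rate_function (R : realType) (I : R -> \bar R) : Prop :=
  [/\ forall x, (0 <= I x)%E,
      lower_semicontinuous I
    & forall a : R, 0 <= a -> compact [set x | (I x <= a%:E)%E]].

(* [lne 0 = -oo]. The term of index 0 does not affect the limits. *)
Definition large_deviation_principle (R : realType) (d : nat -> measure_display)
    (T : forall n, measurableType (d n)) (P : forall n, probability (T n) R)
    (Y : forall n, {RV (P n) >-> R}) (speed : nat -> R) (I : R -> \bar R) :
    Prop :=
  forall A : set R, measurable A ->
    let u n := ((speed n)^-1%:E * lne (P n (Y n @^-1` A)))%E in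
    [/\ (- ereal_inf (I @` A°) <= limn_einf u)%E,
        (limn_einf u <= limn_esup u)%E
      & (limn_esup u <= - ereal_inf (I @` closure A))%E].

(* [ln 0 = 0], so that the convention 0 log 0 = 0 holds. *)
Definition rate_half (R : realType) (x : R) : \bar R :=
  if 2^-1 <= x <= 1 then
    ((2 * x - 1) * ln (2 * x - 1) + 2 * (1 - x) * ln (1 - x)
     + (3 - 2 * x) * ln 2)%:E
  else +oo%E.

(* Main.v *)
Require Import Defs.
From mathcomp Require Import all_boot all_order all_algebra.
From mathcomp Require Import all_classical all_reals all_analysis.
From mathcomp Require Import zify ring lra.

Set Implicit Arguments.
Unset Strict Implicit.
Unset Printing Implicit Defensive.

Import Order.TTheory GRing.Theory Num.Theory.
Import numFieldNormedType.Exports.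

(** Write e_1, ..., e_{n-1} for the coins of the cards 1, ..., n-1, put in front
    of them the virtual value e_0 = 1, and call a fall an index i with
    e_{i-1} = 1 and e_i = 0. The shuffled deck is an increasing run of the cards
    with coin 1, then card n, then a decreasing run of the others. In the
    increasing run the guess of the successor is right exactly for the j with
    e_{j-1} = e_j = 1; card n is guessed right iff e_{n-1} = 1; and the whole
    decreasing run is guessed right. Adding up, the strategy makes n - N correct
    guesses, where N is the number of falls ([nb_correctE]).

    A binary word is determined by the set of its changes of letter, and falls
    are every other change, starting with the first one. Hence exactly
    C(n-1, 2k-1) + C(n-1, 2k) = C(n, 2k) of the 2^(n-1) words have k falls, and
    X_n = n - k has probability C(n, 2k) / 2^(n-1) ([card_nb_correct],
    [prob_fair_coins]).

    With h(t) = t log t + (1 - t) log (1 - t), the rate function on [1/2, 1] is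
    x |-> log 2 + h(2 - 2x) ([rate_halfE]), and 2 - 2x = 2k/n when
    x = (n - k)/n. So all that is left is that C(n, m) = exp(-n h(m/n)) up to a
    factor n + 1, which holds because m is the most likely of the n + 1 values
    of a binomial variable with parameters n and m/n ([bin_le_entropy],
    [bin_ge_entropy]). As X_n takes at most n + 1 values, every event A has
    probability at most 4n exp(-n inf_A I), and at least exp(-n I(y)) / (4n) for
    each value y of X_n/n in A; the large deviation principle follows since
    log(4n)/n tends to 0, and since the values of X_n/n get dense in [1/2, 1],
    where the rate is continuous. *)

(** * Falls and changes in binary words *)

Definition steps (r : rel bool) (b : bool) (w : bitseq) : nat :=
  count id (pairmap r b w).

Definition changes := steps addb.
Definition falls := steps (fun b x => b && ~~ x).

(** Both sides count the letters of [w]: a letter 0 is counted by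
    [count negb], and a letter 1 is either preceded by a 1 (a step of [andb]) or
    by a 0. The latter rises alternate with the falls, so that their numbers
    differ by a boundary term depending on the first and last values. *)
Lemma stays_falls b w :
  steps andb b w + count negb w + last b w + falls b w = size w + b.
Proof.
elim: w b => [|x w IHw] b; first by rewrite /falls /steps /= addn0.
by have := IHw x; rewrite /falls /steps /=; case: b; case: x => /=; lia.
Qed.

(** Falls and rises alternate, and the first change is a fall iff [b] is 1. *)
Lemma falls_changes b w : falls b w = (changes b w + b)./2.
Proof.
elim: w b => [|x w IHw] b; first by case: b.
by rewrite /falls /changes /steps /= -/(steps _ _ _) -/(falls _ _) IHw;
  case: b; case: x; rewrite /= ?addn0 ?addn1 ?addnS ?addSn.
Qed.

Lemma card_tuple_cons n (p : pred bitseq) :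
  #|[pred t : n.+1.-tuple bool | p t]| =
    #|[pred t : n.-tuple bool | p (true :: t)]| +
    #|[pred t : n.-tuple bool | p (false :: t)]|.
Proof.
rewrite -!sum1_card.
pose h (bt : bool * n.-tuple bool) := [tuple of bt.1 :: bt.2].
rewrite (reindex h) /=; last first.
  exists (fun t => (thead t, [tuple of behead t])) => [[b t] _|t _] /=.
    by rewrite /h theadE; congr pair; exact: val_inj.
  by rewrite /h [RHS]tuple_eta.
rewrite big_mkcond -(pair_bigA _ (fun (b : bool) (t : n.-tuple bool) =>
  if p (b :: t) then 1 else 0)) /=.
by rewrite big_bool -!big_mkcond.
Qed.

Lemma card_tuple_take n (p : pred bitseq) :
  #|[pred t : n.+1.-tuple bool | p (take n t)]| =
    2 * #|[pred t : n.-tuple bool | p t]|.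
Proof.
elim: n p => [|n IHn] p.
  rewrite (card_tuple_cons _ (fun s => p (take 0 s))) /= mulSn mul1n.
  by congr addn; apply: eq_card => t; rewrite !inE tuple0.
rewrite (card_tuple_cons _ (fun s => p (take n.+1 s))) card_tuple_cons.
rewrite mulnDr /=.
by rewrite (IHn (fun s => p (true :: s))) (IHn (fun s => p (false :: s))).
Qed.

(** A word is determined by its initial value and the set of positions of its
    changes, which is arbitrary. *)
Lemma card_changes n b c :
  #|[pred t : n.-tuple bool | changes b t == c]| = 'C(n, c).
Proof.
elim: n b c => [|n IHn] b c.
  rewrite (eq_card (B := [pred t : 0.-tuple bool | 0 == c])); last first.
    by move=> t; rewrite !inE tuple0.
  case: c => [|c]; last by rewrite eq_card0.
  by rewrite (eq_card (B := predT)) // card_tuple.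
rewrite (card_tuple_cons _ (fun s => changes b s == c)).
have E x : #|[pred t : n.-tuple bool | changes b (x :: t) == c]| =
    if b (+) x then (if c is c'.+1 then 'C(n, c') else 0) else 'C(n, c).
  rewrite /changes /steps /= -/(steps _ _ _) -/(changes _ _).
  case: (b (+) x) => /=; last exact: IHn.
  by case: c => [|c]; [exact: eq_card0|exact: IHn].
by rewrite !E; case: b {E}; case: c => [|c] /=; rewrite ?bin0 ?binS // addnC.
Qed.

(** Having [k] falls means having [2k] or [2k - 1] changes, whence Pascal's
    formula. *)
Lemma card_falls n k :
  #|[pred t : n.-tuple bool | falls true t == k]| = 'C(n.+1, k.*2).
Proof.
have E : [pred t : n.-tuple bool | falls true t == k] =i
    [pred t : n.-tuple bool | (changes true t == k.*2)
       || (if k is k'.+1 then changes true t == k'.*2.+1 else false)].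
  by move=> t; rewrite !inE falls_changes; case: k => [|k]; lia.
rewrite (eq_card E); case: k {E} => [|k].
  rewrite bin0 -(bin0 n) -(card_changes n true).
  by apply: eq_card => t; rewrite !inE orbF.
rewrite doubleS binS -!(card_changes n true) -cardUI.
rewrite [X in _ = _ + X]eq_card0 ?addn0; last first.
  by move=> t; rewrite !inE; case: eqP => // ->; lia.
by apply: eq_card => t; rewrite !inE.
Qed.

(** * Correct guesses on a shuffled deck *)

(** [x] stands for the last shown card (0 if there is none), and the next candidate for the
    increasing run is [m.+1]: the pending guess [x.+1] can only come out right
    now, namely when [x = m], that is, when the preceding coin is 1. *)
Lemma sum_successors_mask x m w : x <= m ->
  let A := mask w (iota m.+1 (size w)) in
  \sum_(i < size A) ((last x (take i A)).+1 == nth 0 A i) =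
    steps andb (x == m) w.
Proof.
elim: w x m => [|b w IHw] x m lexm /=; first by rewrite big_ord0.
case: b; last first.
  rewrite IHw ?(leqW lexm)// /steps /= andbF add0n.
  by have -> : (x == m.+1) = false by lia.
rewrite big_ord_recl /= (IHw m.+1)// eqxx /steps /= andbT eqSS.
by [].
Qed.

(** Once the rest of the deck is decreasing, the largest unseen card is the
    next one. *)
Lemma bigmax_unseen n shown y rest :
  perm_eq (shown ++ y :: rest) (iota 1 n) -> sorted gtn (y :: rest) ->
  \max_(1 <= j < n.+1 | j \notin shown) j = y.
Proof.
move=> deckP /(order_path_min (fun a b c h1 h2 => ltn_trans h2 h1)) /allP ltry.
have : uniq (shown ++ y :: rest) by rewrite (perm_uniq deckP) iota_uniq.
rewrite cat_uniq => /and3P[_ /hasPn unseen _].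
rewrite /index_iota subn1 /= -(perm_big _ deckP) big_cat /=.
rewrite big_seq_cond big_pred0 => [|j]; last by rewrite andbN.
rewrite max0n big_cons unseen ?mem_head//.
apply/maxn_idPl/bigmax_leqP_seq => j jr _.
exact/ltnW/ltry.
Qed.

Lemma correct_guesses_cat strategy s1 s2 :
  correct_guesses strategy (s1 ++ s2) =
    \sum_(i < size s1) (strategy (take i s1) == nth 0 s1 i) +
    \sum_(i < size s2) (strategy (s1 ++ take i s2) == nth 0 s2 i).
Proof.
rewrite /correct_guesses size_cat big_split_ord /=; congr addn.
  by apply: eq_bigr => i _; rewrite take_cat nth_cat ltn_ord.
apply: eq_bigr => i _.
by rewrite take_cat nth_cat ltnNge leq_addr /= addKn.
Qed.

(** The default value [true] of [last] covers the one-card deck, whose only card is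
    guessed right. *)
Lemma last_coins n (c : pred 'I_n) :
  last true [seq c j | j <- enum 'I_n] =
    (n == 0) || (n \in [seq (val j).+1 | j <- enum 'I_n & c j]).
Proof.
case: n c => [|n] c; first by rewrite (size0nil (size_enum_ord 0)).
rewrite {1}enum_ordSr map_rcons last_rcons /=.
apply/idP/mapP => [cn|[j + [nj]]].
  by exists ord_max => //; rewrite mem_filter cn mem_enum.
by rewrite mem_filter => /andP[cj _]; have <- : j = ord_max by exact: val_inj.
Qed.

Section game.
Variables (n : nat) (c : pred 'I_n).

Let ups := [seq (val j).+1 | j <- enum 'I_n & c j].
Let downs := [seq (val j).+1 | j <- enum 'I_n & ~~ c j].
Let w : bitseq := [seq c j | j <- enum 'I_n].

Let cardsE : [seq (val j).+1 | j <- enum 'I_n] = iota 1 n.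
Proof. by rewrite map_comp val_enum_ord -[1]addn0 iotaDl. Qed.

Let iotaSr : iota 1 n.+1 = rcons (iota 1 n) n.+1.
Proof. by rewrite -cats1; have := iotaD 1 n 1; rewrite addn1 add1n. Qed.

Let deckP : perm_eq (ups ++ n.+1 :: rev downs) (iota 1 n.+1).
Proof.
have cardsP : perm_eq (ups ++ downs) (iota 1 n).
  by rewrite -cardsE -map_cat perm_map//; exact/permPl/perm_filterC.
apply/permP => p; rewrite iotaSr -cats1 !count_cat -(permP cardsP).
by rewrite count_cat /= count_rev; lia.
Qed.

Let sorted_downs : sorted gtn (n.+1 :: rev downs).
Proof.
have -> : n.+1 :: rev downs = rev (rcons downs n.+1) by rewrite rev_rcons.
rewrite rev_sorted -cats1.
apply: (@subseq_sorted _ ltn ltn_trans _ (iota 1 n.+1)).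
  rewrite iotaSr -cats1 cat_subseq// -cardsE map_subseq//.
  exact: filter_subseq.
exact: iota_ltn_sorted.
Qed.

Lemma correct_guesses_falls :
  correct_guesses (optimal_guess n.+1) (ups ++ n.+1 :: rev downs) + falls true w
    = n.+1.
Proof.
have uniq_deck : uniq (ups ++ n.+1 :: rev downs).
  by rewrite (perm_uniq deckP) iota_uniq.
have nS : n.+1 \notin ups.
  by move: uniq_deck; rewrite cat_uniq /= negb_or => /and3P[_ /andP[]].
have upsE : ups = mask w (iota 1 (size w)).
  by rewrite /w size_map size_enum_ord -cardsE -map_mask -filter_mask.
have sorted_ups : sorted ltn ups.
  rewrite (subseq_sorted ltn_trans _ (iota_ltn_sorted 1 n))// -cardsE.
  by rewrite map_subseq// filter_subseq.
have upsP j : j \in ups -> 0 < j <= n.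
  move=> ju; have : j \in iota 1 n.
    rewrite -cardsE; apply: mem_subseq ju.
    by rewrite map_subseq// filter_subseq.
  by rewrite mem_iota add1n ltnS.
have szw : size w = n by rewrite /w size_map size_enum_ord.
rewrite correct_guesses_cat /= big_ord_recl /= cats0.
(* Card n can only be the last one of the increasing run, so that the
   strategy does not switch to decreasing guesses before the run is over. *)
have -> : \sum_(i < size ups) (optimal_guess n.+1 (take i ups) == nth 0 ups i) =
    steps andb true w.
  have := @sum_successors_mask 0 0 w (leqnn 0); rewrite /= -upsE => <-.
  apply: eq_bigr => i _; rewrite /optimal_guess.
  rewrite (negbTE (contra (@mem_take _ _ _ _) nS)) /=.
  case: ifP => // /index_ltn lti; exfalso.
  have := sorted_ltn_nth ltn_trans 0 sorted_ups (index n ups) i.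
  rewrite !inE (ltn_trans lti) ?ltn_ord// => /(_ isT isT lti).
  have ui : nth 0 ups i \in ups by rewrite mem_nth.
  rewrite nth_index; last by rewrite -index_mem (ltn_trans lti).
  by have := upsP _ ui; lia.
(* The guess for card n+1 is right iff card n has just been shown. *)
have -> : optimal_guess n.+1 ups == n.+1 = last true w.
  rewrite last_coins /optimal_guess (negbTE nS) /=; case: ifPn => [nups|nups].
    by rewrite (bigmax_unseen deckP)// eqxx orbT.
  rewrite orbF eqSS; have := mem_last 0 ups.
  rewrite inE => /orP[/eqP->|lu]; first exact: eq_sym.
  have := upsP _ lu; have : last 0 ups != n by apply: contraNneq nups => <-.
  by case: eqP; case: eqP; lia.
have -> : \sum_(i < size (rev downs))
    (optimal_guess n.+1 (ups ++ n.+1 :: take i (rev downs)) ==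
       nth 0 (rev downs) i) = count negb w.
  rewrite (eq_bigr (fun=> 1)) => [|i _].
    rewrite sum1_card card_ord size_rev /downs size_map size_filter.
    by rewrite /w count_map.
  rewrite /optimal_guess mem_cat mem_head orbT /=.
  rewrite (@bigmax_unseen _ _ (nth 0 (rev downs) i) (drop i.+1 (rev downs)))//.
  - by rewrite eqxx.
  - by rewrite -catA /= -drop_nth// cat_take_drop.
  - rewrite -drop_nth//.
    apply: (subseq_sorted _ (drop_subseq (rev downs) i)).
      by move=> a b d h1 h2; exact: ltn_trans h2 h1.
    exact: path_sorted sorted_downs.
by have := stays_falls true w; rewrite szw; lia.
Qed.
End game.

Lemma nb_correctE n (coin : 'I_n.+1 -> bool) :
  nb_correct coin +
    falls true (take n [seq coin j | j <- enum 'I_n.+1]) = n.+1.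
Proof.
rewrite /nb_correct shuffleE enum_ordSr map_rcons -cats1.
rewrite take_size_cat; last by rewrite 2!size_map size_enum_ord.
by rewrite -map_comp; exact: correct_guesses_falls.
Qed.

(** The factor 2 is due to the coin of the last card, which has no effect. *)
Lemma card_nb_correct n k : 0 < n ->
  #|[pred f : {ffun 'I_n -> bool} | nb_correct f + k == n]| = 2 * 'C(n, k.*2).
Proof.
case: n => // n _; rewrite -card_falls.
rewrite -(card_tuple_take n (fun s => falls true s == k)).
pose h (t : n.+1.-tuple bool) := [ffun j => tnth t j].
rewrite -!sum1_card (reindex h) /=; last first.
  exists (fun f : {ffun _} => mktuple f) => [t _|f _].
    by apply: eq_from_tnth => j; rewrite tnth_mktuple ffunE.
  by apply/ffunP => j; rewrite ffunE tnth_mktuple.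
apply: eq_bigl => t; rewrite !inE; have := nb_correctE (h t).
have -> : [seq h t j | j <- enum 'I_n.+1] = t.
  by rewrite -[RHS](map_tnth_enum t); apply: eq_map => j; rewrite ffunE.
move: (nb_correct _) => x nbE; rewrite -[RHS](eqn_add2l x) nbE.
exact: eq_sym.
Qed.

Lemma nb_correct_le n (coin : 'I_n -> bool) : 0 < n -> nb_correct coin <= n.
Proof.
case: n coin => // n coin _.
by rewrite -[X in _ <= X](nb_correctE coin) leq_addr.
Qed.

Local Open Scope classical_set_scope.
Local Open Scope ring_scope.

(** * Entropy bounds on binomial coefficients *)

(** [n ^ n] times the probability that a binomial variable with parameters [n]
    and [m / n] is equal to [j]. *)
Definition binomial_weight (n m j : nat) : nat :=
  ('C(n, j) * m ^ j * (n - m) ^ (n - j))%N.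

Lemma sum_binomial_weight n m : (m <= n)%N ->
  (\sum_(j < n.+1) binomial_weight n m j)%N = (n ^ n)%N.
Proof.
move=> mn; have -> : (n ^ n = (n - m + m) ^ n)%N by rewrite subnK.
rewrite expnDn; apply: eq_bigr => j _.
by rewrite /binomial_weight -mulnA [(m ^ j * _)%N]mulnC.
Qed.

(** The ratio of the weights at [i.+1] and [i] is
    [(n - i) m / ((i + 1) (n - m))], which is at least 1 as long as [i < m];
    the values beyond [m] are reduced to this case by exchanging successes and
    failures. *)
Lemma binomial_weight_mode n m j : (m <= n)%N -> (j <= n)%N ->
  (binomial_weight n m j <= binomial_weight n m m)%N.
Proof.
wlog jm : m j / (j <= m)%N => [hw mn jn|mn _].
  have [/hw->//|/ltnW mj] := leqP j m.
  have wC i : (i <= n)%N ->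
      binomial_weight n m i = binomial_weight n (n - m) (n - i).
    move=> ni; rewrite /binomial_weight bin_sub// !subKn//.
    by rewrite -!mulnA [(m ^ i * _)%N]mulnC.
  by rewrite !wC//; apply: hw; rewrite ?leq_sub2l ?leq_subr.
have step i : (i < m)%N ->
    (binomial_weight n m i <= binomial_weight n m i.+1)%N.
  move=> im; have [|] := posnP (n - m); rewrite /binomial_weight.
    by move=> ->; rewrite [(0 ^ _)%N]exp0n ?muln0// subn_gt0 (leq_trans im).
  move=> nm0; rewrite -(@leq_pmul2l (i.+1 * (n - m))) ?muln_gt0//.
  have -> : (i.+1 * (n - m) * ('C(n, i.+1) * m ^ i.+1 * (n - m) ^ (n - i.+1)) =
      (n - i) * m * ('C(n, i) * m ^ i * (n - m) ^ (n - i)))%N.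
    have H := mul_bin_left n i.
    have -> : ((n - m) ^ (n - i) = (n - m) * (n - m) ^ (n - i.+1))%N.
      by rewrite -expnS subnSK// (leq_trans im).
    rewrite expnS.
    transitivity (i.+1 * 'C(n, i.+1) * (n - m) * (m * m ^ i)
       * (n - m) ^ (n - i.+1))%N; first by ring.
    by rewrite H; ring.
  by rewrite leq_mul2r [(i.+1 * _)%N]mulnC leq_mul ?orbT// leq_sub2l// ltnW.
have climb d : (j + d <= m)%N ->
    (binomial_weight n m j <= binomial_weight n m (j + d))%N.
  elim: d => [|d IHd]; first by rewrite addn0.
  by rewrite addnS => jdm; exact: leq_trans (IHd (ltnW jdm)) (step _ jdm).
by have := climb (m - j)%N; rewrite subnKC//; apply.
Qed.

Lemma binomial_weight_le n m : (m <= n)%N -> (binomial_weight n m m <= n ^ n)%N.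
Proof.
move=> mn; rewrite -(sum_binomial_weight mn) (bigD1 (inord m)) //=.
by rewrite inordK// leq_addr.
Qed.

Lemma binomial_weight_ge n m : (m <= n)%N ->
  (n ^ n <= n.+1 * binomial_weight n m m)%N.
Proof.
move=> mn; rewrite -(sum_binomial_weight mn).
rewrite -[X in (X * _)%N]card_ord -sum_nat_const.
by apply: leq_sum => j _; rewrite binomial_weight_mode// -ltnS.
Qed.

(** * The rate function *)

Section analysis.
Context {R : realType}.
Implicit Types x t : R.

Definition xlnx x : R := x * ln x.
(** The negative of the binary entropy. *)
Definition negent t : R := xlnx t + xlnx (1 - t).

Lemma ln_ge_1BV x : 0 < x -> 1 - x^-1 <= ln x.
Proof.
move=> x0; have := @le_ln1Dx R (x^-1 - 1).
rewrite [1 + _]addrC subrK lnV// => h.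
have : -1 < x^-1 - 1 by rewrite ltrBrDr addNr invr_gt0.
by move=> /h; lra.
Qed.

Lemma xlnx_le x : xlnx x <= x ^+ 2.
Proof.
rewrite /xlnx; have [x0|x0] := leP x 0; first by rewrite ln0// mulr0 sqr_ge0.
have := @le_ln1Dx R (x - 1); rewrite [1 + _]addrC subrK => h.
rewrite expr2 ler_pM2l//; suff : ln x <= x - 1 by lra.
by apply: h; lra.
Qed.

Lemma xlnx_ge x : - (2 * Num.sqrt `|x|) <= xlnx x.
Proof.
rewrite /xlnx; have [x0|x0] := leP x 0.
  by rewrite ln0// mulr0 oppr_le0 mulr_ge0.
rewrite gtr0_norm//; set s := Num.sqrt x.
have s0 : 0 < s by rewrite sqrtr_gt0.
have -> : x = s ^+ 2 by rewrite sqr_sqrtr// ltW.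
rewrite lnXn// mulrnAr -mulr_natl.
have := ler_wpM2l (sqr_ge0 s) (ln_ge_1BV s0).
rewrite mulrBr mulr1 {2}expr2 mulfK ?gt_eqF//.
by have := sqr_ge0 s; lra.
Qed.

(** Since [ln] vanishes on nonpositive numbers, this holds on the whole line. At
    0, the function is squeezed by the two preceding bounds. *)
Lemma continuous_xlnx : continuous xlnx.
Proof.
move=> x; have [x0|x0|->] := ltgtP x 0.
- apply: cvg_near_cst; have := lt_nbhsl x0; apply: filterS => y /ltW y0.
  by rewrite /xlnx !ln0 ?mulr0// ltW.
- by apply: cvgM; [exact: cvg_id|exact: continuous_ln].
rewrite /continuous_at /xlnx mul0r.
apply: (@squeeze_cvgr _ _ _ _ (fun y : R => - (2 * Num.sqrt `|y|))
  (fun y : R => y ^+ 2)).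
- by near=> y; rewrite xlnx_ge xlnx_le.
- rewrite [X in _ --> X](_ : 0 = - (2 * Num.sqrt `|0 : R|)); last first.
    by rewrite normr0 sqrtr0 mulr0 oppr0.
  apply: cvgN; apply: cvgMr.
  apply: (@continuous_comp _ _ _ (fun y : R => `|y|) (@Num.sqrt R)).
    exact: norm_continuous.
  exact: sqrt_continuous.
- rewrite [X in _ --> X](_ : 0 = (0 : R) ^+ 2); last by rewrite expr0n.
  exact: exprn_continuous.
Unshelve. all: by end_near. Qed.

Lemma continuous_negent : continuous negent.
Proof.
move=> t; apply: cvgD; first exact: continuous_xlnx.
apply: (@continuous_comp _ _ _ (fun y : R => 1 - y) xlnx).
  by apply: cvgB; [exact: cvg_cst|exact: cvg_id].
exact: continuous_xlnx.
Qed.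

(** The right-hand side is convex, and the left-hand side is its tangent line at
    1/2, where the entropy is maximal. *)
Lemma xlnx_ge_tangent x : 0 <= x -> x - 2^-1 - x * ln 2 <= xlnx x.
Proof.
rewrite le_eqVlt => /predU1P[<-|x0]; first by rewrite /xlnx !mul0r; lra.
have x20 : 0 < 2 * x by lra.
have := ler_wpM2l (ltW x0) (ln_ge_1BV x20).
rewrite mulrBr mulr1 lnM ?posrE// mulrDr /xlnx invfM mulrCA mulfV ?gt_eqF//.
by lra.
Qed.

Lemma negent_ge t : 0 <= t <= 1 -> 0 <= ln 2 + negent t.
Proof.
move=> /andP[t0 t1]; have := xlnx_ge_tangent t0.
have : 0 <= 1 - t by lra.
by move=> /xlnx_ge_tangent; rewrite /negent; lra.
Qed.

Definition entropy_rate x : R := ln 2 + negent (2 - 2 * x).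

Lemma rate_halfE x : 2^-1 <= x <= 1 ->
  rate_half x = (entropy_rate x)%:E.
Proof.
rewrite /rate_half /entropy_rate => xI; rewrite xI; congr EFin.
case/andP: xI => _.
have -> : negent (2 - 2 * x) = xlnx (2 - 2 * x) + xlnx (2 * x - 1).
  by rewrite /negent; congr (_ + xlnx _); ring.
(* At x = 1 the logarithm of a product does not split: both terms are 0. *)
rewrite le_eqVlt => /predU1P[->|x1].
  by rewrite /xlnx !mulr1 !subrr !mul0r mulr0 !add0r mul0r; lra.
have -> : xlnx (2 - 2 * x) = (2 - 2 * x) * (ln 2 + ln (1 - x)).
  by rewrite -lnM ?posrE ?subr_gt0// mulrBr mulr1.
by rewrite /xlnx; ring.
Qed.

Lemma continuous_entropy_rate : continuous entropy_rate.
Proof.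
move=> x; apply: cvgD; first exact: cvg_cst.
apply: (@continuous_comp _ _ _ (fun y : R => 2 - 2 * y) negent).
  by apply: cvgB; [exact: cvg_cst|apply: cvgMr; exact: cvg_id].
exact: continuous_negent.
Qed.

(** The level sets are those of a continuous function within a segment, which
    makes them compact. *)
Lemma rate_half_level (a : R) : [set x | (rate_half x <= a%:E)%E] =
  `[2^-1, 1] `&` entropy_rate @^-1` [set y | y <= a].
Proof.
apply/seteqP; split => x /=; rewrite in_itv /=.
  have [xI|xI] := boolP (2^-1 <= x <= 1); first by rewrite rate_halfE// lee_fin.
  by rewrite /rate_half (negbTE xI) leye_eq.
by move=> [xI]; rewrite rate_halfE.
Qed.

Lemma closed_rate_half_level (a : R) : closed [set x | (rate_half x <= a%:E)%E].
Proof.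
rewrite rate_half_level; apply: closedI; first exact: itv_closed.
apply: closed_comp => [x _|]; [exact: continuous_entropy_rate|exact: closed_le].
Qed.

Lemma good_rate_half : good_rate_function (@rate_half R).
Proof.
split.
- move=> x; have [xI|xI] := boolP (2^-1 <= x <= 1).
    by rewrite rate_halfE// lee_fin /entropy_rate negent_ge//; move: xI; lra.
  by rewrite /rate_half (negbTE xI).
- apply/lower_semicontinuousP => a; rewrite -closedC.
  rewrite (_ : ~` _ = [set x | (rate_half x <= a%:E)%E]).
    exact: closed_rate_half_level.
  by apply/seteqP; split => x /=; rewrite leNgt => /negP.
- move=> a _; apply: (subclosed_compact (closed_rate_half_level (a:=a))).
    exact: (@segment_compact _ 2^-1 1).
  by rewrite rate_half_level; exact: subIsetl.
Qed.

End analysis.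

(** * Comparison of limits superior and inferior *)

Section limsup.
Context {R : realType}.
Local Open Scope ereal_scope.
Implicit Types u v : (\bar R)^nat.

Lemma le_limn_esup u v : (\forall n \near \oo, u n <= v n) ->
  limn_esup u <= limn_esup v.
Proof.
move=> uv; apply: le_ereal_inf_tmp => _ [V nV <-].
apply: (@le_trans _ _ (ereal_sup (u @` (V `&` [set n | u n <= v n])))).
  apply: ereal_inf_lbound; exists (V `&` [set n | u n <= v n]) => //.
  exact: filterI.
apply: ge_ereal_sup => _ [n [Vn uvn] <-]; apply: (le_trans uvn).
by apply: ereal_sup_ubound; exists n.
Qed.

Lemma limn_esup_le_near u v l : (\forall n \near \oo, u n <= v n) ->
  v @ \oo --> l -> limn_esup u <= l.
Proof. by move=> /le_limn_esup uv /cvg_limn_einf_sup[_ <-]. Qed.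

Lemma limn_einf_ge_near u v l : (\forall n \near \oo, v n <= u n) ->
  v @ \oo --> l -> l <= limn_einf u.
Proof.
move=> uv vl; rewrite /limn_einf leeNr.
apply: (@limn_esup_le_near _ (\- v)); last exact: cvgeN.
by apply: filterS uv => n; rewrite leeN2.
Qed.
End limsup.

(** * Entropy bounds in exponential form *)

Section entropy_bounds.
Context {R : realType}.
Variables n m : nat.
Hypotheses (n0 : (0 < n)%N) (mn : (m <= n)%N).

(* Valid at a = 0 too, thanks to the conventions 0 log 0 = 0 and 0 ^ 0 = 1. *)
Let expR_xlnx a : expR (n%:R * xlnx (a%:R / n%:R : R)) = a%:R ^+ a / n%:R ^+ a.
Proof.
case: a => [|a]; first by rewrite mul0r /xlnx mul0r mulr0 expR0 !expr0 divr1.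
rewrite /xlnx mulrA [n%:R * _]mulrC divfK ?pnatr_eq0 -?lt0n//.
by rewrite expRM_natl lnK ?exprMn ?exprVn// posrE divr_gt0 ?ltr0n.
Qed.

Lemma bin_expR_negent :
  'C(n, m)%:R * expR (n%:R * negent (m%:R / n%:R)) =
    (binomial_weight n m m)%:R / (n ^ n)%:R :> R.
Proof.
have nn0 : n%:R != 0 :> R by rewrite pnatr_eq0 -lt0n.
have -> : negent (m%:R / n%:R) =
    xlnx (m%:R / n%:R) + xlnx ((n - m)%:R / n%:R) :> R.
  by rewrite /negent natrB// mulrBl divff.
rewrite mulrDr expRD !expR_xlnx /binomial_weight !natrM !natrX.
have -> : n%:R ^+ n = n%:R ^+ m * n%:R ^+ (n - m) :> R by rewrite -exprD subnKC.
by rewrite invfM; ring.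
Qed.

Let power2 : expR (- (n%:R * ln 2)) = (2 ^+ n)^-1 :> R.
Proof. by rewrite expRN expRM_natl lnK// posrE. Qed.

Let nn_gt0 : (0 : R) < (n ^ n)%:R.
Proof. by rewrite ltr0n expn_gt0 n0. Qed.

Lemma bin_le_entropy :
  'C(n, m)%:R / 2 ^+ n <= expR (- (n%:R * (ln 2 + negent (m%:R / n%:R)))) :> R.
Proof.
rewrite mulrDr opprD expRD power2 mulrC ler_pM2l ?invr_gt0 ?exprn_gt0//.
rewrite [leRHS]expRN -[leRHS]div1r ler_pdivlMr ?expR_gt0// bin_expR_negent.
by rewrite ler_pdivrMr// mul1r ler_nat binomial_weight_le.
Qed.

Lemma bin_ge_entropy :
  expR (- (n%:R * (ln 2 + negent (m%:R / n%:R)))) <=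
    n.+1%:R * ('C(n, m)%:R / 2 ^+ n) :> R.
Proof.
rewrite mulrDr opprD expRD power2 mulrA [leRHS]mulrC.
rewrite ler_pM2l ?invr_gt0 ?exprn_gt0//.
rewrite expRN -[leLHS]div1r ler_pdivrMr ?expR_gt0// -mulrA bin_expR_negent.
by rewrite mulrA ler_pdivlMr// mul1r -natrM ler_nat binomial_weight_ge.
Qed.
End entropy_bounds.

(** * Fair independent coins are uniformly distributed *)

Section fair_coins.
Context d (T : measurableType d) (R : realType) (P : probability T R) (n : nat).
Variable coin : 'I_n -> {RV P >-> bool}.
Hypothesis coin_bernoulli :
  forall j, distribution P (coin j) = bernoulli_prob (2^-1 : R).
Hypothesis coin_independent : mutually_independent coin.

Let cell (f : {ffun 'I_n -> bool}) : set T :=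
  \bigcap_j (coin j @^-1` [set f j]).

Let measurable_cell f : measurable (cell f).
Proof.
apply: fin_bigcap_measurable => [|j _]; first exact: finite_finset.
by rewrite -[X in measurable X]setTI; exact: measurable_funP.
Qed.

Let prob_coin j b : P (coin j @^-1` [set b]) = (2^-1)%:E.
Proof.
have -> : P (coin j @^-1` [set b]) = distribution P (coin j) [set b] by [].
rewrite coin_bernoulli bernoulli_probE; last by lra.
have in1 b' : (b' \in [set b]) = (b' == b) by apply/idP/eqP; rewrite inE.
rewrite !diracE !in1 /unstable.onem -!EFinM -EFinD; congr EFin.
by case: b {in1} => /=; lra.
Qed.

Let prob_cell f : P (cell f) = ((2 ^+ n)^-1)%:E.
Proof.
rewrite /cell (_ : [set: 'I_n] = [set` [set: 'I_n]%SET]); last first.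
  by apply/seteqP; split => j //= _; rewrite inE.
rewrite (@coin_independent _ (fun j => [set f j]))//.
under eq_bigr do rewrite prob_coin.
by rewrite prodEFin big_const cardsT card_ord iter_mulr_1 exprVn.
Qed.

Lemma prob_fair_coins (p : pred {ffun 'I_n -> bool}) :
  P [set w | p [ffun j => coin j w]] = (#|p|%:R / 2 ^+ n)%:E.
Proof.
have -> : [set w | p [ffun j => coin j w]] = \bigcup_(f in [set` p]) cell f.
  apply/seteqP; split => [w pw|w [f pf fw]].
    by exists [ffun j => coin j w] => // j _; rewrite /preimage /= ffunE.
  have fE : f = [ffun j => coin j w].
    by apply/ffunP => j; rewrite ffunE; exact/esym/fw.
  by move: pf; rewrite /= {1}fE.
rewrite measure_fin_bigcup//; last first.
  by move=> f g _ _ [w [fw gw]]; apply/ffunP => j; rewrite -(fw j)// (gw j).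
rewrite -(bigfs _ (r := index_enum _)) ?index_enum_uniq//; last first.
  by move=> f _; rewrite mem_index_enum.
rewrite (eq_bigr (fun=> ((2 ^+ n)^-1)%:E)) => [|f _]; last exact: prob_cell.
by rewrite sumEFin sumr_const mulr_natl.
Qed.
End fair_coins.

(** * Exponential bounds on the proportion of correct guesses *)

Section correct_ratio_bounds.
Context d (T : measurableType d) (R : realType) (P : probability T R) (n : nat).
Variable coin : 'I_n -> {RV P >-> bool}.
Hypothesis coin_bernoulli :
  forall j, distribution P (coin j) = bernoulli_prob (2^-1 : R).
Hypothesis coin_independent : mutually_independent coin.
Hypothesis n0 : (0 < n)%N.

Let hit (A : set R) : pred {ffun 'I_n -> bool} :=
  fun f => `[< A ((nb_correct f)%:R / n%:R) >].

Let prob_hit A : P (correct_ratio coin @^-1` A) = (#|hit A|%:R / 2 ^+ n)%:E.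
Proof.
rewrite -(prob_fair_coins coin_bernoulli coin_independent).
congr (P _); apply/seteqP; split => w; rewrite /preimage /= /correct_ratio;
  have -> : nb_correct (fun j => coin j w) = nb_correct [ffun j => coin j w]
    by congr nb_correct; apply/funext => j; rewrite ffunE.
- by move=> ?; exact/asboolP.
- by move/asboolP.
Qed.

Let ratioE (f : {ffun 'I_n -> bool}) k : (nb_correct f + k == n)%N ->
  (nb_correct f)%:R / n%:R = 1 - k%:R / n%:R :> R.
Proof.
move=> /eqP fk; have nE : n%:R = (nb_correct f)%:R + k%:R :> R.
  by rewrite -natrD fk.
rewrite -[X in X / _](addrK (k%:R : R)) -nE mulrBl divff//.
by rewrite pnatr_eq0 -lt0n.
Qed.

Let card_hit_le A :
  (#|hit A| <=
     \sum_(k < n.+1 | `[< A (1 - k%:R / n%:R)%R >]) 2 * 'C(n, k.*2))%N.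
Proof.
pose defect (f : {ffun 'I_n -> bool}) : 'I_n.+1 := inord (n - nb_correct f).
have defectE (f : {ffun _}) : (nb_correct f + defect f == n)%N.
  by rewrite /defect inordK ?subnKC ?nb_correct_le// ltnS leq_subr.
rewrite -sum1_card (partition_big defect
  (fun k : 'I_n.+1 => `[< A (1 - k%:R / n%:R)%R >])) /=; last first.
  by move=> f; rewrite -(ratioE (defectE f)).
apply: leq_sum => k _; rewrite -card_nb_correct// sum1_card.
apply/subset_leq_card/fintype.subsetP => f; rewrite !inE => /andP[_ /eqP <-].
exact: defectE.
Qed.

Let half_ratio (k : nat) : 2 - 2 * (1 - k%:R / n%:R) = k.*2%:R / n%:R :> R.
Proof. by rewrite -mul2n natrM; ring. Qed.

Let ratio_itv (k : nat) : (k.*2 <= n)%N -> 2^-1 <= (1 - k%:R / n%:R : R) <= 1.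
Proof.
rewrite -(ler_nat R) -mul2n natrM => kn.
have : k%:R / n%:R <= 2^-1 :> R by rewrite ler_pdivrMr ?ltr0n//; lra.
have : 0 <= k%:R / n%:R :> R by rewrite divr_ge0.
by lra.
Qed.

(** Here [c] is any lower bound of the rate on the values in [A] that the
    proportion can take. In particular, [c] is arbitrary if there are none: the
    probability is then 0. *)
Lemma prob_correct_ratio_le (A : set R) c :
  (forall k, (k.*2 <= n)%N -> A (1 - k%:R / n%:R) ->
    (c%:E <= rate_half (1 - k%:R / n%:R : R))%E) ->
  (P (correct_ratio coin @^-1` A) <= ((4 * n)%:R * expR (- (n%:R * c)))%:E)%E.
Proof.
move=> cA; rewrite prob_hit lee_fin ler_pdivrMr ?exprn_gt0//.
have := card_hit_le A; rewrite -(ler_nat R) => /le_trans; apply.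
rewrite natr_sum.
apply: (@le_trans _ _ (\sum_(k < n.+1) 2 * (expR (- (n%:R * c)) * 2 ^+ n))).
  rewrite big_mkcond /=; apply: ler_sum => k _.
  case: ifPn => [/asboolP Ak|_]; last first.
    by rewrite !mulr_ge0 ?expR_ge0 ?exprn_ge0.
  rewrite natrM ler_pM2l//; have [kn|kn] := leqP k.*2 n; last first.
    by rewrite bin_small// mulr_ge0 ?expR_ge0 ?exprn_ge0.
  rewrite -ler_pdivrMr ?exprn_gt0//; apply: (le_trans (bin_le_entropy n0 kn)).
  rewrite ler_expR lerN2 ler_pM2l ?ltr0n//.
  have := cA _ kn Ak; rewrite rate_halfE /entropy_rate ?half_ratio ?lee_fin//.
  exact: ratio_itv.
rewrite sumr_const card_ord -[leLHS]mulr_natl mulrA -natrM mulrA.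
rewrite ler_pM2r ?exprn_gt0// ler_pM2r ?expR_gt0// ler_nat.
by lia.
Qed.

Lemma prob_correct_ratio_ge (A : set R) k : (k.*2 <= n)%N ->
  A (1 - k%:R / n%:R) ->
  ((expR (- (n%:R * entropy_rate (1 - k%:R / n%:R))) / (4 * n)%:R)%:E <=
     P (correct_ratio coin @^-1` A))%E.
Proof.
move=> kn Ak; rewrite /entropy_rate half_ratio prob_hit.
rewrite lee_fin ler_pdivrMr ?ltr0n ?muln_gt0//.
apply: (le_trans (bin_ge_entropy n0 kn)).
rewrite mulrA [leRHS]mulrAC ler_pM2r ?invr_gt0 ?exprn_gt0//.
rewrite -!natrM ler_nat mulnC leq_mul//; last by lia.
apply: (@leq_trans (2 * 'C(n, k.*2))%N); first exact: leq_pmull.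
rewrite -card_nb_correct//; apply/subset_leq_card/fintype.subsetP => f.
rewrite !inE => fk.
by rewrite (ratioE fk).
Qed.
End correct_ratio_bounds.

(** * The large deviation principle *)

Section asymptotics.
Context {R : realType}.

Lemma cvg_invn : (fun n => n%:R^-1 : R) @ \oo --> (0 : R).
Proof. by rewrite -cvg_shiftS; exact: cvg_harmonic. Qed.

Lemma cvg_ln_over_n : (fun n => ln (4 * n)%:R / n%:R : R) @ \oo --> (0 : R).
Proof.
rewrite -cvg_shiftS /=.
(* log(m)/m is the opposite of y log y at y = 1/m, which tends to 0. *)
have -> : (fun n => ln (4 * n.+1)%:R / n.+1%:R) =
    (fun n => ln 4 * n.+1%:R^-1 - xlnx (n.+1%:R^-1)) :> (nat -> R).
  apply/funext => n.
  rewrite /xlnx natrM lnM ?posrE ?ltr0n// lnV ?posrE ?ltr0n//.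
  by rewrite mulrN opprK mulrDl [X in _ + X]mulrC.
have lim0 : ln 4 * 0 - xlnx 0 = 0 :> R by rewrite /xlnx mul0r mulr0 subr0.
suff : (fun n => ln 4 * n.+1%:R^-1 - xlnx (n.+1%:R^-1) : R) @ \oo -->
    (ln 4 * 0 - xlnx 0 : R) by rewrite lim0.
apply: cvgB; first exact: cvgMr cvg_harmonic.
by apply: continuous_cvg; [exact: continuous_xlnx|exact: cvg_harmonic].
Qed.

(** Rounding down makes [1 - grid x n / n], the point of the lattice approaching
    [x], at least [x]; if [x] is at least 1/2, so is this point, so that it is a value of the
    proportion of correct guesses. *)
Definition grid (x : R) n : nat := Num.truncn (n%:R * (1 - x)).

Lemma grid_le x n : 2^-1 <= x <= 1 -> ((grid x n).*2 <= n)%N.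
Proof.
move=> /andP[x2 x1]; rewrite -(ler_nat R) -mul2n natrM.
have nx0 : 0 <= n%:R * (1 - x) by rewrite mulr_ge0//; lra.
have : (grid x n)%:R <= n%:R * (1 - x) by rewrite /grid truncn_le.
have : n%:R * (1 - x) <= n%:R * 2^-1 by rewrite ler_wpM2l//; lra.
by lra.
Qed.

Lemma cvg_grid x : x <= 1 -> (fun n => 1 - (grid x n)%:R / n%:R) @ \oo --> x.
Proof.
move=> x1.
apply: (@squeeze_cvgr _ _ _ _ (cst x) (fun n => x + n%:R^-1)).
- near=> n.
  have n0 : (0 : R) < n%:R by rewrite ltr0n; near: n; exact: nbhs_infty_gt.
  have /truncn_itv : 0 <= n%:R * (1 - x) by rewrite mulr_ge0//; lra.
  rewrite -/(grid x n) => /andP[lo hi]; apply/andP; split.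
    rewrite /cst lerBrDr addrC -lerBrDr ler_pdivrMr// mulrC; exact: lo.
  have : 1 - x <= ((grid x n)%:R + 1) / n%:R.
    by rewrite ler_pdivlMr// mulrC natr1 ltW.
  by rewrite mulrDl div1r; lra.
- exact: cvg_cst.
- rewrite -[X in _ --> X]addr0; apply: cvgD; first exact: cvg_cst.
  exact: cvg_invn.
Unshelve. all: by end_near. Qed.
End asymptotics.

Section scaled_log.
Context {R : realType}.
Variables (n : nat) (p : \bar R) (b : R).
Hypotheses (p0 : (0 <= p)%E) (b0 : 0 < b).
Local Open Scope ereal_scope.

Let in_b : b%:E \in `[0, +oo].
Proof. by rewrite in_itv /= leey lee_fin ltW. Qed.

Let in_p : p \in `[0, +oo].
Proof. by rewrite in_itv /= leey p0. Qed.

Lemma scaled_lne_le : p <= b%:E -> (n%:R^-1)%:E * lne p <= (ln b / n%:R)%:E.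
Proof.
move=> pb; rewrite mulrC EFinM lee_wpmul2l ?lee_fin ?invr_ge0//.
by rewrite -lne_EFin// lee_lne.
Qed.

Lemma scaled_lne_ge : b%:E <= p -> (ln b / n%:R)%:E <= (n%:R^-1)%:E * lne p.
Proof.
move=> bp; rewrite mulrC EFinM lee_wpmul2l ?lee_fin ?invr_ge0//.
by rewrite -lne_EFin// lee_lne.
Qed.
End scaled_log.

Section ldp.
Context (R : realType) (d : nat -> measure_display)
    (T : forall n, measurableType (d n)) (P : forall n, probability (T n) R)
    (coin : forall n, 'I_n -> {RV (P n) >-> bool}).
Hypothesis coin_bernoulli : forall n (j : 'I_n),
      distribution (P n) (coin j) = bernoulli_prob (2^-1 : R).
Hypothesis coin_independent : forall n, mutually_independent (coin (n := n)).
Local Open Scope ereal_scope.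

Let u (A : set R) n : \bar R :=
  (n%:R^-1)%:E * lne (P n (correct_ratio (coin (n := n)) @^-1` A)).

Lemma ldp_upper (A : set R) :
  limn_esup (u A) <= - ereal_inf (@rate_half R @` closure A).
Proof.
(* Real lower bounds of the infimum also settle the case of the infimum +oo,
   which is above every real number. *)
have bound c : c%:E <= ereal_inf (@rate_half R @` closure A) ->
    limn_esup (u A) <= (- c)%:E.
  move=> cI; apply: (@limn_esup_le_near _ _
    (fun n => (ln (4 * n)%:R / n%:R - c)%:E)); last first.
    apply: cvg_EFin; first by near=> n.
    rewrite -[X in _ --> X](sub0r c); apply: cvgB; last exact: cvg_cst.
    exact: cvg_ln_over_n.
  near=> n; have n0 : (0 < n)%N by near: n; exact: nbhs_infty_gt.
  have n0R : (0 < n%:R :> R)%R by rewrite ltr0n.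
  have := @prob_correct_ratio_le _ _ _ _ _ _
    (coin_bernoulli (n := n)) (@coin_independent n) n0 A c.
  have cA k : (k.*2 <= n)%N -> A (1 - k%:R / n%:R)%R ->
      c%:E <= rate_half (1 - k%:R / n%:R)%R.
    move=> _ Ak; apply: (le_trans cI); apply: ereal_inf_lbound.
    by exists (1 - k%:R / n%:R)%R => //; exact: subset_closure.
  move=> /(_ cA) /scaled_lne_le; rewrite /u => h.
  apply: le_trans (h n _ _) _ => //.
    by rewrite mulr_gt0 ?ltr0n ?muln_gt0 ?expR_gt0.
  rewrite lnM ?posrE ?ltr0n ?muln_gt0 ?expR_gt0// expRK lee_fin.
  by rewrite mulrBl [(n%:R * c)%R]mulrC mulfK ?gt_eqF.
move: bound; case: (ereal_inf _) => [r| |] bound.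
- exact: bound.
- rewrite leeNy_eq; apply/eqP/eq_ninfty => r.
  by rewrite -(opprK r); apply: bound; rewrite leey.
- by rewrite /= leey.
Unshelve. all: by end_near. Qed.

Lemma ldp_lower (A : set R) :
  - ereal_inf (@rate_half R @` A°) <= limn_einf (u A).
Proof.
rewrite leeNl; apply: le_ereal_inf_tmp => _ [x Ax <-].
rewrite leeNl.
have [xI|xI] := boolP (2^-1 <= x <= 1)%R; last first.
  by rewrite /rate_half (negbTE xI) leNye.
rewrite rate_halfE//.
apply: (@limn_einf_ge_near _ _ (fun n =>
   (- (entropy_rate (1 - (grid x n)%:R / n%:R)
       + ln (4 * n)%:R / n%:R))%:E)); last first.
  apply: cvg_EFin; first by near=> n.
  apply: cvgN; rewrite -[X in _ --> X]addr0.
  apply: cvgD; last exact: cvg_ln_over_n.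
  apply: continuous_cvg; first exact: continuous_entropy_rate.
  by apply: cvg_grid; case/andP: xI.
have nearA : \forall n \near \oo, A (1 - (grid x n)%:R / n%:R)%R.
  have x1 : (x <= 1)%R by case/andP: xI.
  by have := cvg_grid x1; apply; exact: Ax.
near=> n; have n0 : (0 < n)%N by near: n; exact: nbhs_infty_gt.
have n0R : (0 < n%:R :> R)%R by rewrite ltr0n.
have An : A (1 - (grid x n)%:R / n%:R)%R by near: n.
have := @prob_correct_ratio_ge _ _ _ _ _ _
  (coin_bernoulli (n := n)) (@coin_independent n) n0 A _ (grid_le n xI) An.
move=> /scaled_lne_ge h; rewrite /u; apply: le_trans (h n _ _) => //.
  rewrite ln_div ?posrE ?ltr0n ?muln_gt0 ?expR_gt0// expRK lee_fin.
  by rewrite mulrBl mulNr [(n%:R * _)%R]mulrC mulfK ?gt_eqF// opprD.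
by rewrite divr_gt0 ?ltr0n ?muln_gt0 ?expR_gt0.
Unshelve. all: by end_near. Qed.
End ldp.

Theorem corollary4 (R : realType) (d : nat -> measure_display)
    (T : forall n, measurableType (d n)) (P : forall n, probability (T n) R)
    (coin : forall n, 'I_n -> {RV (P n) >-> bool})
    (coin_bernoulli : forall n (j : 'I_n),
      distribution (P n) (coin n j) = bernoulli_prob (2^-1 : R))
    (coin_independent : forall n, mutually_independent (coin n)) :
  good_rate_function (@rate_half R) /\
  large_deviation_principle (fun n => correct_ratio (coin n) : {RV (P n) >-> R})
    (fun n => n%:R) (@rate_half R).
Proof.
split; first exact: good_rate_half.
move=> A _; split; [exact: ldp_lower|exact: limn_einf_sup|exact: ldp_upper].
Qed.
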